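(* Let $n\geq 4$, and let $G$ be an $n$-vertex $3$-chromatic $2$-connected graph. Then the following hold. \begin{itemize} \item If $n$ is odd, then $i_2(G)\leq i_2(C_n)$, with equality if and only if $G=C_n$. \item If $n$ is even, then $i_2(G)\leq i_2(\theta_{a,b,c})$ for every $n$-vertex theta graph $\theta_{a,b,c}$ in which at least one of $a,b,c$ is even, with equality if and only if $G$ is an $n$-vertex theta graph $\theta_{a',b',c'}$ in which at least one of $a',b',c'$ is even. \item For all $3\leq t\leq n-2$, $i_t(G)\leq i_t(K_2\vee E_{n-2})$, and for $n\geq 5$ equality holds if and only if $G=K_2\vee E_{n-2}$. \end{itemize} Equality of graphs is understood up to isomorphism.
   Context: All graphs are finite and simple. An independent set of $G$ is a set of vertices no two of which are adjacent; $i_t(G)$ denotes the number of independent sets of $G$ having exactly $t$ vertices. A graph is $k$-chromatic if its chromatic number is exactly $k$. A graph $G$ is $\ell$-connected if $|V(G)|>\ell$ and any graph obtained by deleting fewer than $\ell$ vertices is connected. $C_n$ is the cycle on $n$ vertices; $K_m$ and $E_m$ denote the complete and the empty (edgeless) graph on $m$ vertices; $G_1\vee G_2$ denotes the join: the graph with vertex set $V(G_1)\sqcup V(G_2)$ and edge set $E(G_1)\cup E(G_2)\cup\{xy: x\in V(G_1), y\in V(G_2)\}$. A theta graph $\theta_{a,b,c}$ joins two distinct vertices $v$ and $w$ by three internally disjoint paths of (edge) lengths $a$, $b$, $c\ge 1$ (at most one of the lengths equals $1$, since graphs are simple); it has $a+b+c-1$ vertices. *)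

(* Defs.v *)
From mathcomp Require Import all_boot.
Set Implicit Arguments.
Unset Strict Implicit.
Unset Printing Implicit Defensive.

Record sgraph := SGraph {
  vertex :> finType;
  adj : rel vertex;
  adj_sym : symmetric adj;
  adj_irr : irreflexive adj }.

Definition graph_iso (G H : sgraph) : Prop :=
  exists2 f : G -> H, bijective f & forall x y, adj (f x) (f y) = adj x y.

Definition independent (G : sgraph) (S : {set G}) : bool :=
  [forall x in S, forall y in S, ~~ adj x y].

Definition indep_count (t : nat) (G : sgraph) : nat :=
  #|[set S : {set G} | independent S & #|S| == t]|.

Definition colorable (G : sgraph) (k : nat) : bool :=
  [exists f : {ffun G -> 'I_k}, forall x, forall y, adj x y ==> (f x != f y)].

Lemma colorable_exists (G : sgraph) : exists k, colorable G k.
Proof.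
exists #|G|; apply/existsP; exists [ffun x => enum_rank x].
apply/forallP=> x; apply/forallP=> y; apply/implyP=> xy.
rewrite !ffunE (inj_eq enum_rank_inj).
by apply: contraTneq xy => ->; rewrite adj_irr.
Qed.

Definition chromatic_number (G : sgraph) : nat := ex_minn (colorable_exists G).

Definition connected (G : sgraph) : Prop := forall x y : G, connect (@adj G) x y.

Section Induced.
Variables (G : sgraph) (A : {set G}).
Definition induced_adj : rel {x : G | x \in A} :=
  [rel x y | adj (val x) (val y)].
Lemma induced_sym : symmetric induced_adj.
Proof. by move=> x y; apply: adj_sym. Qed.
Lemma induced_irr : irreflexive induced_adj.
Proof. by move=> x; apply: adj_irr. Qed.
Definition induced : sgraph := SGraph induced_sym induced_irr.
End Induced.

Definition vertex_connected (l : nat) (G : sgraph) : Prop :=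
  l < #|G| /\ forall S : {set G}, #|S| < l -> connected (induced (~: S)).

(* The conjunct x != y only matters for n = 1, where ordS has a fixed point. *)
Section Cycle.
Variable n : nat.
Definition cycle_adj : rel 'I_n :=
  [rel x y | (x != y) && ((y == ordS x) || (x == ordS y))].
Lemma cycle_sym : symmetric cycle_adj.
Proof. by move=> x y; rewrite /cycle_adj /= eq_sym orbC. Qed.
Lemma cycle_irr : irreflexive cycle_adj.
Proof. by move=> x; rewrite /cycle_adj /= eqxx. Qed.
Definition cycle_graph : sgraph := SGraph cycle_sym cycle_irr.
End Cycle.

Section CompleteEmpty.
Variable m : nat.
Lemma complete_sym : symmetric [rel x y : 'I_m | x != y].
Proof. by move=> x y; rewrite /= eq_sym. Qed.
Lemma complete_irr : irreflexive [rel x y : 'I_m | x != y].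
Proof. by move=> x; rewrite /= eqxx. Qed.
Definition complete_graph : sgraph := SGraph complete_sym complete_irr.

Lemma empty_sym : symmetric [rel x y : 'I_m | false].
Proof. by []. Qed.
Lemma empty_irr : irreflexive [rel x y : 'I_m | false].
Proof. by []. Qed.
Definition empty_graph : sgraph := SGraph empty_sym empty_irr.
End CompleteEmpty.

Section Join.
Variables G H : sgraph.
Definition join_adj : rel (G + H) :=
  fun x y => match x, y with
  | inl u, inl v => adj u v
  | inr u, inr v => adj u v
  | _, _ => true
  end.
Lemma join_sym : symmetric join_adj.
Proof. by move=> [x|x] [y|y] //=; apply: adj_sym. Qed.
Lemma join_irr : irreflexive join_adj.
Proof. by move=> [x|x]; apply: adj_irr. Qed.
Definition join_graph : sgraph := SGraph join_sym join_irr.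
End Join.

(* The vertices of the theta graph are the ends v = inl false and w = inl true,
   and the a-1, b-1 and c-1 internal vertices of the three paths. Each vertex
   is given its distance from v along each of the paths on which it lies; two
   vertices are adjacent when these differ by one on some path. *)
Section Theta.
Variables a b c : nat.
Definition theta_vertex : finType := (bool + ('I_a.-1 + 'I_b.-1 + 'I_c.-1))%type.
Definition theta_pos (x : theta_vertex) : option nat * option nat * option nat :=
  match x with
  | inl false => (Some 0, Some 0, Some 0)
  | inl true => (Some a, Some b, Some c)
  | inr (inl (inl i)) => (Some i.+1, None, None)
  | inr (inl (inr i)) => (None, Some i.+1, None)
  | inr (inr i) => (None, None, Some i.+1)
  end.
Definition consecutive (p q : option nat) : bool :=
  if (p, q) is (Some i, Some j) then (j == i.+1) || (i == j.+1) else false.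
Definition theta_adj : rel theta_vertex :=
  fun x y => let: (p1, p2, p3) := theta_pos x in
             let: (q1, q2, q3) := theta_pos y in
             [|| consecutive p1 q1, consecutive p2 q2 | consecutive p3 q3].
Lemma consecutive_sym : symmetric consecutive.
Proof. by move=> [i|] [j|]; rewrite /consecutive // orbC. Qed.
Lemma consecutive_irr : irreflexive consecutive.
Proof. by move=> [i|]; rewrite /consecutive // orbb ltn_eqF. Qed.
Lemma theta_sym : symmetric theta_adj.
Proof.
move=> x y; rewrite /theta_adj.
case: (theta_pos x) => [[p1 p2] p3]; case: (theta_pos y) => [[q1 q2] q3].
by rewrite (consecutive_sym p1) (consecutive_sym p2) (consecutive_sym p3).
Qed.
Lemma theta_irr : irreflexive theta_adj.
Proof.
move=> x; rewrite /theta_adj; case: (theta_pos x) => [[p1 p2] p3].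
by rewrite !consecutive_irr.
Qed.
Definition theta_graph : sgraph := SGraph theta_sym theta_irr.

Definition theta_lengths : bool :=
  [&& 0 < a, 0 < b, 0 < c & count_mem 1 [:: a; b; c] <= 1].
Definition some_even : bool := [|| ~~ odd a, ~~ odd b | ~~ odd c].
End Theta.

Lemma card_theta a b c :
  theta_lengths a b c -> #|theta_graph a b c| = a + b + c - 1.
Proof.
case/and4P=> a0 b0 c0 _.
rewrite !card_sum card_bool !card_ord.
by case: a b c a0 b0 c0 => [|a] [|b] [|c] // _ _ _; rewrite !addnS !addSn subn1.
Qed.

(* Main.v *)
Require Import Defs.
From mathcomp Require Import all_boot zify.

(** The case [t = 2] is a count of edges.  Every 2-connected graph has minimum
degree at least 2, and twice the number of independent pairs plus the degree
sum is [n (n - 1)] ([indep_count2]), so maximising pairs means minimising the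
degree sum, which is at least [2n].  If it equals [2n], the graph is [C_n]: it
contains a cycle, and a connected graph of minimum degree 2 has no room for
anything else ([embedding_iso]).  For even [n] the cycle is bipartite, and by
parity the least possible degree sum is [2n + 2].  A graph with this degree sum
has a vertex [v] with three neighbours; joining two of them, and then the
third, inside the connected graph [G - v] produces a theta graph
([exists_theta]), whose excess [sum (deg - 2) = 2] already exhausts that of [G],
so again [embedding_iso] leaves nothing else.  A theta graph with three odd
lengths is bipartite, hence the parity condition.

The case [t >= 3] uses only that degrees are at least 2, until the very end.
At least two vertices outside an independent set of size [t] cannot extend it,
namely the neighbours of one of its elements; counting extensions gives
[(t + 1) i_{t+1} <= (n - 2 - t) i_t] ([indep_count_step]).  The numbers
[C(n - 2, t)] satisfy this with equality, so both the bound and the equality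
case descend to [t = 3].  There Goodman's count applies: a triple that is
neither independent nor complete has exactly two vertices seeing one of the
others and missing the other, so the number of such triples is
[1/2 sum d (n - 1 - d)] ([goodman]).  When all degrees lie between 2 and [n - 3]
each summand is at least [2 (n - 3)], which is more than enough.  A vertex of
degree at least [n - 2] lies in no independent triple and is deleted; in the
rest all degrees are positive, and the same alternative arises one level
lower: either Goodman's count gives a strict inequality, or a second vertex can
be deleted, which leaves [n - 2] vertices and at most [C(n - 2, 3)] triples, with
equality only if they are independent.  Then every remaining vertex is joined
to both deleted ones, and these are adjacent because [G] is not bipartite. *)

Set Implicit Arguments.
Unset Strict Implicit.
Unset Printing Implicit Defensive.

(** * Counting independent sets by their extensions *)

Definition nbhd (G : sgraph) (x : G) : {set G} := [set y | adj x y].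
Notation degree x := #|nbhd x|.

Lemma independentP (G : sgraph) (S : {set G}) :
  reflect {in S &, forall x y, ~~ adj x y} (independent S).
Proof.
apply: (iffP forall_inP) => [h x y xS yS|h x xS].
  by have /forall_inP := h x xS; apply.
by apply/forall_inP => y yS; apply: h.
Qed.

Lemma independentS (G : sgraph) (S T : {set G}) :
  S \subset T -> independent T -> independent S.
Proof.
move=> /subsetP ST /independentP h; apply/independentP => x y /ST xT /ST yT.
exact: h.
Qed.

Lemma independentU1 (G : sgraph) (x : G) (S : {set G}) :
  independent (x |: S) = independent S && [disjoint nbhd x & S].
Proof.
apply/idP/andP => [ind|[/independentP ind dis]].
  split; first exact: independentS (subsetUr _ _) ind.
  apply/pred0P => y /=; rewrite inE; apply/andP => -[xy yS].
  move/independentP: ind => /(_ x y); rewrite !inE eqxx yS orbT xy.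
  by move=> /(_ isT isT).
have nx y : y \in S -> ~~ adj x y.
  move=> yS; apply/negP => xy; move/pred0P: dis => /(_ y) /=.
  by rewrite inE xy yS.
apply/independentP => y z; rewrite !inE.
move=> /predU1P[->|yS] /predU1P[->|zS]; rewrite ?adj_irr //; first exact: nx.
  by rewrite adj_sym nx.
exact: ind.
Qed.

Definition indep_sets (t : nat) (G : sgraph) : {set {set G}} :=
  [set S | independent S & #|S| == t].

Definition extensions (G : sgraph) (S : {set G}) : {set G} :=
  [set x | x \notin S & independent (x |: S)].

(** Double counting of the pairs [(T, x)] with [T] independent of size [t + 1]
and [x] in [T], matched with [(T :\ x, x)]. *)
Lemma indep_count_extend (G : sgraph) (t : nat) :
  t.+1 * indep_count t.+1 G = \sum_(S in indep_sets t G) #|extensions S|.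
Proof.
have -> : t.+1 * indep_count t.+1 G = \sum_(T in indep_sets t.+1 G) #|T|.
  rewrite mulnC -sum_nat_const; apply: eq_bigr => T.
  by rewrite inE => /andP[_ /eqP->].
transitivity (\sum_(T in indep_sets t.+1 G) \sum_(x in T) 1).
  by apply: eq_bigr => T _; rewrite sum1_card.
transitivity (\sum_(S in indep_sets t G) \sum_(x in extensions S) 1); last first.
  by apply: eq_bigr => S _; rewrite sum1_card.
rewrite (exchange_big_dep predT) //= [RHS](exchange_big_dep predT) //=.
apply: eq_bigr => x _.
rewrite (reindex_onto (fun S => x |: S) (fun T => T :\ x)) /=; last first.
  by move=> T /andP[_ xT]; rewrite setD1K.
apply: eq_bigl => S; rewrite !inE eqxx /= andbT cardsU1.
have [xS|xS] := boolP (x \in S); last first.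
  rewrite setU1K // eqxx add1n eqSS andbT /=.
  have [ind|_] := boolP (independent (x |: S)); last by rewrite andbF.
  by rewrite (independentS (subsetUr _ _) ind) !andbT.
rewrite andbF; apply/negbTE; rewrite negb_and; apply/orP; right.
by apply: contraTN xS => /eqP <-; rewrite !inE eqxx.
Qed.

(** The vertices extending a singleton are its non-neighbours, so this is
[indep_count_extend] at [t = 1]. *)
Lemma indep_count2 (G : sgraph) :
  2 * indep_count 2 G + \sum_(x : G) degree x = #|G| * #|G|.-1.
Proof.
rewrite indep_count_extend.
have -> : \sum_(S in indep_sets 1 G) #|extensions S|
        = \sum_(x : G) #|extensions [set x]|.
  rewrite -(big_imset (h := set1) (fun S => #|extensions S|)) /=; last first.
    by move=> x y _ _; apply: set1_inj.
  apply: eq_bigl => S; rewrite inE; apply/andP/imsetP => [[_ /cards1P[x ->]]|].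
    by exists x.
  move=> [x _ ->]; rewrite cards1; split=> //.
  by apply/independentP => y z /set1P-> /set1P->; rewrite adj_irr.
rewrite -big_split /= -sum_nat_const; apply: eq_bigr => x _.
have -> : extensions [set x] = ~: [set x] :\: nbhd x.
  apply/setP => y; rewrite !inE independentU1 andbC; congr (_ && _).
  have -> /= : independent [set x].
    by apply/independentP => u z /set1P-> /set1P->; rewrite adj_irr.
  by rewrite disjoint_sym disjoints1 inE adj_sym.
rewrite cardsD (setIidPr _) ?subnK.
- by rewrite cardsC1.
- apply: subset_leq_card; apply/subsetP => y; rewrite !inE.
  by apply: contraTneq => ->; rewrite adj_irr.
- by apply/subsetP => y; rewrite !inE; apply: contraTneq => ->; rewrite adj_irr.
Qed.

(** * Goodman's count of triples *)

Definition mixed_at (G : sgraph) (T : {set G}) (x : G) : bool :=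
  [exists y in T, exists z in T, [&& adj x y, z != x & ~~ adj x z]].

(** In a triple [a, y, z] with [a ~ y] and [a] not adjacent to [z], one of [y]
and [z] is not mixed: [y] if [y ~ z], and [z] otherwise. *)
Lemma mixed_triple (G : sgraph) (T : {set G}) :
  #|T| = 3 -> 2 * independent T + #|[set x in T | mixed_at T x]| <= 2.
Proof.
move=> T3; have [indT|_] := boolP (independent T).
  rewrite [X in _ + X](_ : _ = 0) //; apply/eqP; rewrite cards_eq0.
  apply/eqP/setP => x; rewrite !inE; apply/negP => /andP[xT].
  move=> /exists_inP[y yT /exists_inP[z _ /and3P[xy _ _]]].
  by move/independentP: indT => /(_ x y xT yT); rewrite xy.
rewrite /= -ltnS -T3; apply/proper_card/properP; split.
  by apply/subsetP => x; rewrite inE => /andP[].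
have [a aT] : exists a, a \in T by apply/set0Pn; rewrite -card_gt0 T3.
have [/exists_inP[y yT /exists_inP[z zT /and3P[ay za az]]]|am] :=
  boolP (mixed_at T a); last by exists a; rewrite ?inE ?aT.
have ya : y != a by apply: contraTneq ay => ->; rewrite adj_irr.
have yz : y != z by apply: contraTneq ay => ->.
have TE : T = [set a; y; z].
  apply/esym/eqP; rewrite eqEcard T3; apply/andP; split.
    by apply/subsetP => u; rewrite !inE -orbA => /or3P[]/eqP->.
  by rewrite -setUA cardsU1 cards2 !inE negb_or yz eq_sym ya eq_sym za.
have [yz_adj|yz_adj] := boolP (adj y z).
  exists y => //; rewrite inE yT /=; apply/exists_inP => -[u _ /exists_inP[v]].
  rewrite TE !inE -orbA => /or3P[]/eqP-> /and3P[_]; rewrite ?eqxx //.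
    by rewrite adj_sym ay.
  by rewrite yz_adj.
exists z => //; rewrite inE zT /=; apply/exists_inP => -[u].
rewrite TE !inE -orbA => /or3P[]/eqP-> /exists_inP[v _ /and3P[]].
- by rewrite adj_sym (negPf az).
- by rewrite adj_sym (negPf yz_adj).
- by rewrite adj_irr.
Qed.

(** A neighbour [y] and a non-neighbour [z] of [x] make [x] mixed in [x, y, z],
and both can be read off from this triple. *)
Lemma mixed_pairs (G : sgraph) (A : {set G}) (x : G) : x \in A ->
  #|nbhd x :&: A| * (#|A|.-1 - #|nbhd x :&: A|)
    <= #|[set T : {set G} | [&& T \subset A, #|T| == 3, x \in T & mixed_at T x]]|.
Proof.
move=> xA.
pose Y := nbhd x :&: A; pose Z := (A :\ x) :\: nbhd x.
have cZ : #|Z| = #|A|.-1 - #|Y|.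
  rewrite /Z cardsD [#|A|](cardsD1 x) xA /=; congr (_ - #|pred_of_set _|).
  apply/setP => y; rewrite !inE [in RHS]andbC; case: eqP => //= ->.
  by rewrite adj_irr andbF.
rewrite -/Y -cZ -cardsX.
pose f (p : G * G) := [set x; p.1; p.2].
have YZ p : p \in setX Y Z ->
    [/\ p.1 \in A, p.2 \in A, adj x p.1, p.2 != x & ~~ adj x p.2].
  by case: p => y z; rewrite !inE /= => /andP[/andP[-> ->] /and3P[-> -> ->]].
have inj : {in setX Y Z &, injective f}.
  move=> [y z] [y' z'] /YZ[/= _ _ xy zx xz] /YZ[/= _ _ xy' zx' xz'] E.
  have yx : y != x by apply: contraTneq xy => ->; rewrite adj_irr.
  have yE : y = y'.
    have : y \in f (y', z') by rewrite -E !inE eqxx orbT.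
    rewrite !inE /= (negPf yx) /= => /orP[/eqP//|/eqP yz'].
    by rewrite yz' (negPf xz') in xy.
  congr (_, _) => //.
  have : z \in f (y', z') by rewrite -E !inE eqxx orbT.
  rewrite !inE /= (negPf zx) /= => /orP[/eqP zy|/eqP//].
  by rewrite zy xy' in xz.
rewrite -(card_in_imset inj); apply/subset_leq_card/subsetP => T.
case/imsetP => -[y z] /YZ[/= yA zA xy zx xz] ->{T}; rewrite inE.
have yx : y != x by apply: contraTneq xy => ->; rewrite adj_irr.
have yz : y != z by apply: contraTneq xy => ->.
apply/and4P; split.
- by apply/subsetP => u; rewrite !inE -orbA => /or3P[]/eqP->.
- rewrite /f /= -setUA cardsU1 cards2 !inE negb_or.
  by rewrite yz [x == y]eq_sym [x == z]eq_sym yx zx.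
- by rewrite !inE eqxx.
- apply/exists_inP; exists y; rewrite ?inE ?eqxx ?orbT //.
  by apply/exists_inP; exists z; rewrite ?inE ?eqxx ?orbT // xy zx.
Qed.

(** Sum over the triples of [A] the bound of [mixed_triple], and count the
mixed vertices from the side of the vertices by [mixed_pairs]. *)
Lemma goodman (G : sgraph) (A : {set G}) :
  2 * #|[set T : {set G} | [&& independent T, #|T| == 3 & T \subset A]]|
    + \sum_(x in A) #|nbhd x :&: A| * (#|A|.-1 - #|nbhd x :&: A|)
  <= 2 * 'C(#|A|, 3).
Proof.
pose D := [set T : {set G} | T \subset A & #|T| == 3].
have -> : #|[set T : {set G} | [&& independent T, #|T| == 3 & T \subset A]]|
        = \sum_(T in D) independent T.
  rewrite -sum1_card [RHS]big_mkcond [LHS]big_mkcond; apply: eq_bigr => T _.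
  by rewrite !inE; case: (independent T); case: (T \subset A); case: (#|T| == 3).
have le : \sum_(x in A) #|nbhd x :&: A| * (#|A|.-1 - #|nbhd x :&: A|)
          <= \sum_(T in D) #|[set x in T | mixed_at T x]|.
  apply: leq_trans (leq_sum _ (fun x => @mixed_pairs G A x)) _.
  under eq_bigr do rewrite -sum1_card.
  under [leqRHS]eq_bigr do rewrite -sum1_card.
  rewrite (exchange_big_dep (fun T => T \in D)) /=; last first.
    by move=> x T _; rewrite !inE => /and4P[-> ->].
  apply: leq_sum => T TD; rewrite !sum1_card.
  apply/subset_leq_card/subsetP => x.
  by rewrite unfold_in !inE => /and5P[_ _ _ -> ->].
apply: leq_trans (leq_add (leqnn _) le) _.
rewrite big_distrr -big_split /= -cards_draws mulnC -sum_nat_const.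
by apply: leq_sum => T; rewrite inE => /andP[_ /eqP]; apply: mixed_triple.
Qed.

(** * Independent triples in graphs of minimum degree two *)

Definition indep_triples (G : sgraph) (A : {set G}) : {set {set G}} :=
  [set T | [&& independent T, #|T| == 3 & T \subset A]].

(** A vertex with at most one non-neighbour in [A] lies in no independent
triple of [A]. *)
Lemma triples_del (G : sgraph) (A : {set G}) (v : G) : v \in A ->
  #|A| <= #|nbhd v :&: A| + 2 -> indep_triples A = indep_triples (A :\ v).
Proof.
move=> vA big; apply/setP => T; rewrite !inE; case indT: (independent T) => //=.
case T3: (#|T| == 3) => //=; apply/idP/idP => [TA|]; last first.
  by move/subset_trans; apply; apply: subsetDl.
rewrite subsetD1 TA /=; apply/negP => vT.
have : T \subset A :\: nbhd v.
  rewrite subsetD TA /= disjoint_sym; apply/pred0P => y /=; rewrite inE.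
  apply/andP => -[vy yT]; move/independentP: indT => /(_ v y vT yT).
  by rewrite vy.
move/subset_leq_card; rewrite (eqP T3) cardsD setIC.
lia.
Qed.

(** In the equality case every pair of vertices of [A] lies in some triple of
[A], which is independent. *)
Lemma triples_max (G : sgraph) (A : {set G}) :
  #|indep_triples A| <= 'C(#|A|, 3) /\
  (3 <= #|A| -> #|indep_triples A| = 'C(#|A|, 3) -> independent A).
Proof.
have sub : indep_triples A \subset [set T : {set G} | T \subset A & #|T| == 3].
  by apply/subsetP => T; rewrite !inE => /and3P[_ -> ->].
rewrite -cards_draws; split; first exact: subset_leq_card.
move=> A3 /eqP; rewrite eq_sym => eqc.
have /setP all : indep_triples A = [set T : {set G} | T \subset A & #|T| == 3].
  by apply/eqP; rewrite eqEcard sub (eqP eqc) leqnn.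
apply/independentP => x y xA yA; apply/negP => xy.
have yx : y != x by apply: contraTneq xy => ->; rewrite adj_irr.
have /set0Pn[z] : A :\: [set x; y] != set0.
  rewrite -card_gt0 cardsD subn_gt0; apply: leq_trans A3; rewrite ltnS.
  by apply: leq_trans (subset_leq_card (subsetIr _ _)) _; rewrite cards2; case: eqP.
rewrite !inE negb_or -andbA => /and3P[zx zy zA].
have := all [set z; x; y]; rewrite !inE -setUA cardsU1 cards2 !inE.
rewrite negb_or zx zy [x == y]eq_sym yx eqxx andbT /= andbC.
rewrite (_ : z |: [set x; y] \subset A = true) /=; last first.
  by apply/subsetP => u; rewrite !inE => /or3P[]/eqP->.
by move=> /independentP/(_ x y); rewrite !inE !eqxx !orbT xy => /(_ isT isT).
Qed.

Lemma mul2_bin2 (m : nat) : 2 * 'C(m, 2) = m * m.-1.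
Proof. by rewrite -mul_bin_diag bin1. Qed.

(** If some vertex dominates [A], it can be deleted.  Otherwise the degrees
[d] inside [A] satisfy [1 <= d <= m - 1], so [d (m - d) >= m - 1], and Goodman's
count excludes at least [(m + 1)(m - 1) / 2] triples, more than the
[C(m, 2)] that separate [C(m + 1, 3)] from [C(m, 3)]. *)
Lemma triples_isolated_free (G : sgraph) (A : {set G}) (m : nat) :
  #|A| = m.+1 -> 3 <= m -> {in A, forall x, 0 < #|nbhd x :&: A|} ->
  #|indep_triples A| <= 'C(m, 3) /\
  (#|indep_triples A| = 'C(m, 3) -> exists2 x, x \in A & independent (A :\ x)).
Proof.
move=> Am m3 deg1.
have [/exists_inP[x xA dx]|] := boolP [exists x in A, m <= #|nbhd x :&: A|].
  rewrite (triples_del xA); last by rewrite Am; lia.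
  have cA : #|A :\ x| = m by move: (cardsD1 x A); rewrite xA Am; lia.
  have [le eq] := triples_max (A :\ x); rewrite cA in le eq.
  by split=> // /(eq m3); exists x.
rewrite negb_exists_in => /forall_inP small.
suff : #|indep_triples A| < 'C(m, 3) by move=> lt; split=> [|E]; lia.
have := goodman A; rewrite -/(indep_triples A) Am /=.
have : m.+1 * m.-1 <= \sum_(x in A) #|nbhd x :&: A| * (m - #|nbhd x :&: A|).
  rewrite -Am -sum_nat_const; apply: leq_sum => x xA.
  by move: (deg1 _ xA) (small _ xA); set d := #|_ :&: _|; nia.
rewrite mulSn (binS m 2) -(mul2_bin2 m); move: (\sum_(x in A) _) #|indep_triples A| => S T.
by move: 'C(m, 3) 'C(m, 2) => c d; lia.
Qed.

(** The same alternative one level up: a vertex with at most one non-neighbour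
is deleted, which lowers all other degrees by at most one.  Otherwise every
degree satisfies [2 <= d <= m - 1], so [d (m + 1 - d) >= 2 (m - 1)], and at least
[(m + 2)(m - 1)] triples are excluded, more than
[C(m + 2, 3) - C(m, 3) = m ^ 2]. *)
Lemma triples_mindeg2 (G : sgraph) (m : nat) :
  #|G| = m.+2 -> 3 <= m -> (forall x : G, 2 <= degree x) ->
  indep_count 3 G <= 'C(m, 3) /\
  (indep_count 3 G = 'C(m, 3) ->
   exists v w : G, v != w /\ independent (~: [set v; w])).
Proof.
move=> Gm m3 deg2.
have -> : indep_count 3 G = #|indep_triples [set: G]|.
  by apply: eq_card => T; rewrite !inE subsetT andbT.
have [/existsP[v dv]|] := boolP [exists v : G, m <= degree v].
  rewrite (triples_del (in_setT v)) ?setIT ?cardsT ?Gm; last by lia.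
  have cA : #|[set: G] :\ v| = m.+1.
    by move: (cardsD1 v [set: G]); rewrite in_setT cardsT Gm; lia.
  have [|le eq] := triples_isolated_free cA m3.
    move=> x _; have := deg2 x; rewrite (cardsD1 v (nbhd x)).
    by rewrite setTD -setDE; case: (v \in _); lia.
  split=> // /eq[w]; rewrite !inE andbT => wv ind; exists v, w.
  by split; [rewrite eq_sym | rewrite setCU -setDE -setTD].
rewrite negb_exists => /forallP small.
suff : #|indep_triples [set: G]| < 'C(m, 3) by move=> lt; split=> [|E]; lia.
have := goodman [set: G]; rewrite -/(indep_triples [set: G]) cardsT Gm /=.
have : m.+2 * (2 * m.-1) <= \sum_(x in [set: G])
    #|nbhd x :&: [set: G]| * (m.+1 - #|nbhd x :&: [set: G]|).
  rewrite -Gm -cardsT -sum_nat_const; apply: leq_sum => x _.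
  by rewrite setIT; move: (deg2 x) (small x); set d := degree x; nia.
rewrite mulnCA !mulSn -(mul2_bin2 m) (binS m.+1 2) (binS m 2) (binS m 1) bin1.
move: (\sum_(x in _) _) #|_| => S T.
by move: 'C(m, 3) 'C(m, 2) => c d; lia.
Qed.

(** * Larger independent sets *)

(** The [t] elements of an independent set and at least two neighbours of any
one of them cannot extend it. *)
Lemma indep_count_step (G : sgraph) (m t : nat) :
  #|G| = m.+2 -> (forall x : G, 2 <= degree x) -> 0 < t ->
  t.+1 * indep_count t.+1 G <= (m - t) * indep_count t G.
Proof.
move=> Gm deg2 t0; rewrite indep_count_extend [leqRHS]mulnC -sum_nat_const.
apply: leq_sum => S; rewrite inE => /andP[indS /eqP St].
have [y yS] : exists y, y \in S by apply/set0Pn; rewrite -card_gt0 St.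
have dS : [disjoint nbhd y & S].
  apply/pred0P => z /=; rewrite inE; apply/andP => -[yz zS].
  by move/independentP: indS => /(_ y z yS zS); rewrite yz.
have : extensions S \subset ~: (nbhd y :|: S).
  apply/subsetP => x; rewrite !inE independentU1 => /and3P[xS _ dx].
  rewrite negb_or xS andbT; apply/negP => yx.
  by move/pred0P: dx => /(_ y) /=; rewrite inE adj_sym yx yS.
move/subset_leq_card/leq_trans; apply; rewrite cardsCs setCK cardsU.
by rewrite (disjoint_setI0 dS) cards0 St Gm; move: (deg2 y); clear; lia.
Qed.

(** The recurrence of [indep_count_step] is an equality for [C(m, t)], with
nonzero factors in this range, so equality at [t + 1] forces equality at [t]. *)
Lemma indep_count_mindeg2 (G : sgraph) (m t : nat) :
  #|G| = m.+2 -> (forall x : G, 2 <= degree x) -> 3 <= t <= m ->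
  indep_count t G <= 'C(m, t) /\
  (indep_count t G = 'C(m, t) ->
   exists v w : G, v != w /\ independent (~: [set v; w])).
Proof.
move=> Gm deg2; elim: t => // t IH /andP[t3 tm].
have [t2|t3'] := leqP t 2.
  have -> : t = 2 by lia.
  by apply: triples_mindeg2 => //; lia.
have [|le eq] := IH; first by rewrite t3' ltnW.
have step := indep_count_step Gm deg2 (leq_trans _ t3' : 0 < t).
have binE := mul_bin_left m t.
have mt : 0 < m - t by rewrite subn_gt0.
split=> [|E].
  rewrite -(leq_pmul2l (ltn0Sn t)) binE; apply: leq_trans (step isT) _.
  by rewrite leq_pmul2l.
apply: eq; apply/eqP; rewrite eqn_leq le /=.
by rewrite -(leq_pmul2l mt) -binE -E step.
Qed.

(** * Isomorphisms and the extremal join *)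

Lemma graph_iso_sym (G H : sgraph) : graph_iso G H -> graph_iso H G.
Proof.
case=> f [g fK gK] fadj; exists g; first by exists f.
by move=> x y; rewrite -fadj !gK.
Qed.

Lemma indep_count_le_iso (t : nat) (G H : sgraph) :
  graph_iso G H -> indep_count t G <= indep_count t H.
Proof.
case=> f /bij_inj finj fadj.
rewrite /indep_count -(card_imset _ (imset_inj finj)).
apply/subset_leq_card/subsetP => T /imsetP[S]; rewrite inE => /andP[indS St] ->.
rewrite inE card_imset // St andbT; apply/independentP => x' y'.
move=> /imsetP[x xS ->] /imsetP[y yS ->]; rewrite fadj.
by move/independentP: indS; apply.
Qed.

Lemma indep_count_iso (t : nat) (G H : sgraph) :
  graph_iso G H -> indep_count t G = indep_count t H.
Proof.
move=> iso; apply/eqP; rewrite eqn_leq !indep_count_le_iso //.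
exact: graph_iso_sym.
Qed.

(** An independent set of size at least 2 avoids the clique side. *)
Lemma indep_count_join (m t : nat) : 2 <= t ->
  indep_count t (join_graph (complete_graph 2) (empty_graph m)) = 'C(m, t).
Proof.
move=> t2; set J := join_graph _ _.
rewrite -[m in RHS]card_ord -[#|_| in RHS](card_imset _ (@inr_inj 'I_2 'I_m)).
rewrite -cards_draws.
apply: eq_card => S; rewrite !inE andbC [RHS]andbC; case St: (#|S| == t) => //=.
apply/independentP/subsetP => [ind x xS|sub x y]; last first.
  by move=> /sub /imsetP[i _ ->] /sub /imsetP[j _ ->].
case: x xS => [i|i] iS; last by rewrite imset_f.
have : 0 < #|S :\ (inl i : J)| by move: (cardsD1 (inl i : J) S); rewrite iS (eqP St); lia.
case/card_gt0P => y; rewrite !inE => /andP[yi yS].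
have := ind _ _ iS yS; case: y yi yS => [j|j] //=.
by rewrite eq_sym => /negP ji _; rewrite negbK.
Qed.

Lemma colorable2_bool (G : sgraph) (f : G -> bool) :
  (forall x y, adj x y -> f x != f y) -> colorable G 2.
Proof.
move=> fP; apply/existsP; exists [ffun x => if f x then ord0 else ord_max].
apply/forallP => x; apply/forallP => y; apply/implyP => /fP; rewrite !ffunE.
by case: (f x); case: (f y).
Qed.

(** Minimum degree 2 joins every vertex of the independent part to both [v] and
[w]; if these two were not adjacent, the graph would be bipartite. *)
Lemma join_iso (G : sgraph) (m : nat) (v w : G) :
  #|G| = m.+2 -> (forall x : G, 2 <= degree x) -> ~~ colorable G 2 ->
  v != w -> independent (~: [set v; w]) ->
  graph_iso G (join_graph (complete_graph 2) (empty_graph m)).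
Proof.
move=> Gm deg2 ncol vw ind; apply: graph_iso_sym.
set B := ~: [set v; w] in ind.
have cB : m = #|B| by rewrite cardsCs setCK cards2 vw Gm; lia.
have nB x : x \in B -> adj v x && adj w x.
  move=> xB; have sub : nbhd x \subset [set v; w].
    apply/subsetP => y; rewrite inE => xy; apply: contraTT xy => yN.
    by move/independentP: ind; apply; rewrite // inE.
  have /eqP E : nbhd x == [set v; w] by rewrite eqEcard sub cards2 vw deg2.
  have : (v \in nbhd x) && (w \in nbhd x) by rewrite E !inE !eqxx orbT.
  by rewrite !inE ![adj x _]adj_sym.
have vw_adj : adj v w.
  apply: contraNT ncol => nvw; apply: (@colorable2_bool _ (mem B)) => x y xy.
  apply/eqP => /= E; have [xB|xB] := boolP (x \in B).
    have yB : y \in B by rewrite -E.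
    by move/independentP: ind => /(_ x y xB yB); rewrite xy.
  have yB : y \notin B by rewrite -E.
  move: xB yB xy; rewrite !inE !negbK.
  by move=> /orP[]/eqP-> /orP[]/eqP->; rewrite ?adj_irr ?[adj w v]adj_sym ?(negPf nvw).
pose g (x : 'I_2 + 'I_m) : G := match x with
  | inl i => if i == ord0 then v else w
  | inr i => enum_val (cast_ord cB i) end.
have gB i : g (inr i) \in B by apply: enum_valP.
have ginl i : g (inl i) \notin B.
  by rewrite !inE negbK /=; case: ifP; rewrite eqxx ?orbT.
have ginj : injective g.
  move=> [i|i] [j|j] E.
  - congr inl; apply/val_inj; move: E => /=.
    case: i j => [[|[|i]] li] [[|[|j]] lj] //= E; first by rewrite E eqxx in vw.
    by rewrite E eqxx in vw.
  - by move: (ginl i) (gB j); rewrite E => /negPf->.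
  - by move: (ginl j) (gB i); rewrite -E => /negPf->.
  - by congr inr; move/enum_val_inj/cast_ord_inj: E.
exists g.
  by apply: inj_card_bij => //; rewrite card_sum !card_ord Gm.
move=> [i|i] [j|j].
- case: i j => [[|[|i]] li] [[|[|j]] lj] //=; rewrite ?adj_irr //.
  by rewrite adj_sym.
- have /andP[vj wj] := nB _ (gB j).
  by rewrite /= ; case: ifP.
- have /andP[vi wi] := nB _ (gB i).
  by rewrite adj_sym /=; case: ifP.
- by apply/negbTE; move/independentP: ind; apply.
Qed.

(** * Paths and degrees in 2-connected graphs *)

Lemma path_avoiding (G : sgraph) (l : nat) (S : {set G}) (x y : G) :
  vertex_connected l G -> #|S| < l -> x \notin S -> y \notin S ->
  exists p, [/\ path (@adj G) x p, last x p = y, uniq (x :: p)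
              & all [predC S] (x :: p)].
Proof.
case=> _ conn Sl xS yS.
have xC : x \in ~: S by rewrite inE.
have yC : y \in ~: S by rewrite inE.
have /connectP[p pp yE] := conn S Sl (Sub x xC) (Sub y yC).
case: (shortenP pp) yE => q qq uq _ yE.
exists (map val q); split.
- by rewrite -[x]/(val (Sub x xC : {z | z \in ~: S})) path_map.
- by rewrite -[x]/(val (Sub x xC : {z | z \in ~: S})) last_map -yE.
- rewrite -[x]/(val (Sub x xC : {z | z \in ~: S})) -map_cons map_inj_uniq //.
  exact: val_inj.
- rewrite /= xS all_map; apply/allP => z _ /=; have := valP z; by rewrite inE.
Qed.

(** Deleting the neighbourhood of a vertex of degree at most 1 would isolate
it. *)
Lemma mindeg2_of_2connected (G : sgraph) :
  vertex_connected 2 G -> forall x : G, 2 <= degree x.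
Proof.
move=> conn x; rewrite leqNgt; apply/negP => small.
have xN : x \notin nbhd x by rewrite inE adj_irr.
have /set0Pn[y] : ~: (x |: nbhd x) != set0.
  rewrite -card_gt0 cardsCs setCK subn_gt0 cardsU1 xN.
  by case: conn => G2 _; apply: leq_ltn_trans G2; rewrite add1n.
rewrite !inE negb_or => /andP[yx xy].
have [|[|z p] [pp lp _ /= Np]] := path_avoiding (y := y) conn small xN.
- by rewrite inE.
- by rewrite -lp eqxx in yx.
- by move: pp Np => /= /andP[xz _]; rewrite !inE xz andbF.
Qed.

Lemma connected_of_2connected (G : sgraph) : vertex_connected 2 G -> connected G.
Proof.
move=> conn x y.
have [|||p [pp lp _ _]] := @path_avoiding G 2 set0 x y conn; rewrite ?inE ?cards0 //.
by apply/connectP; exists p.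
Qed.

(** Rigidity of sparse graphs.  The last hypothesis compares the excesses
[sum (deg - 2)]: that of [G] is at most that of [H].  As degrees can only grow
along an embedding, and vertices outside the image have nonnegative excess,
every vertex of [H] keeps its degree.  So the image has no edges beyond those of
[H] and none leaving it, and by connectedness it is everything. *)
Lemma embedding_iso (G H : sgraph) (f : H -> G) (x0 : H) :
  injective f -> (forall x y, adj x y -> adj (f x) (f y)) ->
  connected G -> (forall y : G, 2 <= degree y) ->
  \sum_(y : G) degree y + 2 * #|H| <= \sum_(x : H) degree x + 2 * #|G| ->
  graph_iso G H.
Proof.
move=> finj fhom conn deg2 excess.
have sub x : f @: nbhd x \subset nbhd (f x).
  by apply/subsetP => _ /imsetP[y xy ->]; rewrite inE in xy; rewrite inE fhom.
have le x : degree x <= degree (f x).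
  by rewrite -(card_imset _ finj); apply: subset_leq_card.
have split_sum : \sum_(y : G) degree y
    = \sum_(x : H) degree (f x) + \sum_(y in ~: (f @: [set: H])) degree y.
  rewrite (bigID (fun y => y \in f @: [set: H])) /=; congr (_ + _).
    by rewrite big_imset /=; [apply: eq_bigl => x; rewrite inE | move=> x y _ _ /finj].
  by apply: eq_bigl => y; rewrite inE.
have outside : 2 * (#|G| - #|H|) <= \sum_(y in ~: (f @: [set: H])) degree y.
  rewrite -[#|H|]cardsT -(card_imset _ finj) -(cardsC (f @: [set: H])).
  by rewrite addKn mulnC -sum_nat_const; apply: leq_sum.
have HG : #|H| <= #|G| by apply: leq_card finj.
have eqd x : degree x = degree (f x).
  apply/eqP; rewrite eqn_leq le /= leqNgt; apply/negP => lt.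
  suff : \sum_(x : H) degree x < \sum_(x : H) degree (f x) by lia.
  rewrite (bigD1 x) //= [ltnRHS](bigD1 x) //= -addSn.
  by apply: leq_add => //; apply: leq_sum.
have nbE x : nbhd (f x) = f @: nbhd x.
  by apply/esym/eqP; rewrite eqEcard sub card_imset // eqd leqnn.
have onto y : y \in codom f.
  have /connectP[p] := conn (f x0) y.
  elim/last_ind: p y => [|p z IH] y; first by move=> _ ->; apply: codom_f.
  rewrite rcons_path last_rcons => /andP[pp pz] ->.
  have /codomP[x xE] := IH _ pp erefl.
  have : z \in nbhd (f x) by rewrite inE -xE.
  by rewrite nbE => /imsetP[u _ ->]; apply: codom_f.
apply: graph_iso_sym; exists f.
  apply: inj_card_bij => //; rewrite -(card_codom finj).
  by apply/subset_leq_card/subsetP => y _; apply: onto.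
move=> x y; apply/idP/idP; last exact: fhom.
have -> : adj (f x) (f y) = (f y \in nbhd (f x)) by rewrite inE.
by rewrite nbE mem_imset // inE.
Qed.

(** * Degree sums of cycles and theta graphs *)

Lemma degree_bool_sum (G : sgraph) :
  \sum_(x : G) degree x = \sum_(x : G) \sum_(y : G) adj x y.
Proof.
apply: eq_bigr => x _; rewrite -sum1_card [LHS]big_mkcond; apply: eq_bigr => y _.
by rewrite inE; case: (adj x y).
Qed.

Lemma cycle_degree_sum (n : nat) : 3 <= n ->
  \sum_(x : cycle_graph n) degree x = 2 * n.
Proof.
move=> n3; rewrite degree_bool_sum.
have E (x y : 'I_n) : cycle_adj x y = (y == ordS x) + (x == ordS y) :> nat.
  have nS (u : 'I_n) : ordS u != u.
    rewrite -val_eqE /=; have := ltn_ord u; rewrite leq_eqVlt => /orP[/eqP un|un].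
      by rewrite un modnn; lia.
    by rewrite modn_small //; lia.
  rewrite /cycle_adj /=.
  have [->|_] := eqVneq y (ordS x); last first.
    by have [->|_] := eqVneq x (ordS y); rewrite ?nS // andbF.
  rewrite eq_sym nS /=; have [/(congr1 val)/=|//] := eqVneq x (ordS (ordS x)).
  have := ltn_ord x; set k := nat_of_ord x => kn.
  have [e|e] := leqP n k.+1.
    have -> : k.+1 = n by lia.
    by rewrite modnn modn_small; lia.
  rewrite (modn_small e); have [e'|e'] := leqP n k.+2.
    have -> : k.+2 = n by lia.
    by rewrite modnn; lia.
  by rewrite modn_small; lia.
under eq_bigr => x _ do (under eq_bigr => y _ do rewrite /= E).
under eq_bigr do rewrite big_split /=.
rewrite big_split /=; rewrite [X in _ + X]exchange_big /= addnn -mul2n; congr (2 * _).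
rewrite -[RHS](card_ord n) -sum1_card; apply: eq_bigr => x _.
by rewrite (bigD1 (ordS x)) //= eqxx big1 // => y /negPf->.
Qed.

Lemma consecutive_sum (a : nat) :
  \sum_(i < a.+1) \sum_(j < a.+1) consecutive (Some (i : nat)) (Some (j : nat)) = 2 * a.
Proof.
have E (i j : 'I_a.+1) : consecutive (Some (i : nat)) (Some (j : nat))
    = (j == i.+1 :> nat) + (i == j.+1 :> nat) :> nat.
  by rewrite /consecutive; case: eqP; case: eqP => //; lia.
under eq_bigr => i _ do (under eq_bigr => j _ do rewrite E).
under eq_bigr do rewrite big_split /=.
rewrite big_split /=; rewrite [X in _ + X]exchange_big /= addnn -mul2n; congr (2 * _).
rewrite big_ord_recr /= [X in _ + X]big1 ?addn0; last first.
  by move=> j _; rewrite ltn_eqF.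
transitivity (\sum_(i < a) 1); last by rewrite sum1_card card_ord.
apply: eq_bigr => i _.
rewrite (bigD1 (lift ord0 i)) //= eqxx big1 // => j; rewrite -val_eqE /=.
by move=> /negPf->.
Qed.

(** The two ends come first and the internal positions after, as in the vertex
type of a theta graph. *)
Lemma path_sum (F : nat -> nat) (n : nat) : 0 < n ->
  F 0 + F n + \sum_(i < n.-1) F i.+1 = \sum_(i < n.+1) F i.
Proof.
by case: n => // n _; rewrite big_ord_recl big_ord_recr /= -addnA [F n.+1 + _]addnC.
Qed.

Definition theta_coord (a b c : nat) (k : 'I_3) (x : theta_vertex a b c) :
    option nat :=
  let: (p1, p2, p3) := theta_pos x in nth None [:: p1; p2; p3] k.

(** The coordinate along the [k]-th path identifies the vertices of that path
with the positions from 0 to its length; elsewhere it is [None]. *)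
Lemma theta_coord_sum (a b c : nat) (k : 'I_3) (F : option nat -> nat) :
  0 < a -> 0 < b -> 0 < c -> F None = 0 ->
  \sum_(x : theta_vertex a b c) F (theta_coord k x)
    = \sum_(i < (nth 0 [:: a; b; c] k).+1) F (Some (i : nat)).
Proof.
move=> a0 b0 c0 F0; rewrite !big_sumType big_bool /= /theta_coord /=.
by case: k => -[|[|[|k]]] lk //=; rewrite !F0 ![\sum_(_ < _) 0]big1 // ?addn0 ?add0n
  [F (Some _) + F _]addnC (path_sum (fun i => F (Some i))).
Qed.

(** Only the two ends lie on more than one path, and they are consecutive on at
most one, because at most one length is 1. *)
Lemma theta_adj_sum (a b c : nat) (x y : theta_vertex a b c) :
  theta_lengths a b c ->
  theta_adj x y = \sum_(k < 3) consecutive (theta_coord k x) (theta_coord k y) :> nat.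
Proof.
rewrite !big_ord_recl big_ord0 /= /theta_lengths /= => /and4P[a0 b0 c0 abc].
rewrite /theta_adj /theta_coord.
move: x y => [[]|[[i|i]|i]] [[]|[[j|j]|j]] /=; rewrite /consecutive ?addn0 /=; lia.
Qed.

Lemma theta_degree_sum (a b c : nat) : theta_lengths a b c ->
  \sum_(x : theta_graph a b c) degree x = 2 * (a + b + c).
Proof.
move=> len; have /and4P[a0 b0 c0 _] := len; rewrite degree_bool_sum.
under eq_bigr => x _ do (under eq_bigr => y _ do rewrite /= theta_adj_sum //).
under eq_bigr do rewrite exchange_big /=.
rewrite exchange_big /=.
transitivity (\sum_(k < 3) 2 * nth 0 [:: a; b; c] k); last first.
  by rewrite !big_ord_recl big_ord0 /=; lia.
apply: eq_bigr => k _; rewrite -consecutive_sum.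
rewrite (@theta_coord_sum a b c k
  (fun p => \sum_y consecutive p (theta_coord k y))) //; last by rewrite big1.
apply: eq_bigr => i _.
by rewrite (@theta_coord_sum a b c k (fun q => consecutive (Some (i : nat)) q)).
Qed.

(** * Cycles and theta graphs inside 2-connected graphs *)

(** Close up at [v] a path between two neighbours of [v] in [G - v]. *)
Lemma exists_cycle (G : sgraph) : vertex_connected 2 G ->
  exists k, 3 <= k /\ exists2 f : cycle_graph k -> G,
    injective f & forall x y, adj x y -> adj (f x) (f y).
Proof.
move=> conn; have deg2 := mindeg2_of_2connected conn.
have /card_gt0P[v _] : 0 < #|G| by case: conn => G2 _; apply: leq_trans G2.
have /card_gt1P[u1 [u2 []]] := deg2 v; rewrite !inE => vu1 vu2 u12.
have nv u : adj v u -> u \notin [set v].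
  by move=> vu; rewrite inE; apply: contraTneq vu => ->; rewrite adj_irr.
have c1 : #|[set v]| < 2 by rewrite cards1.
have [p [pp lp up vp]] := path_avoiding conn c1 (nv _ vu1) (nv _ vu2).
pose c := v :: u1 :: p.
have uc : uniq c.
  rewrite /c cons_uniq up andbT; apply/negP => /(allP vp).
  by rewrite /= inE eqxx.
exists (size c); split.
  by rewrite /c; case: (p) (lp) => //= E; rewrite E eqxx in u12.
pose f (i : cycle_graph (size c)) := nth v c i.
have fS i : adj (f i) (f (ordS i)).
  rewrite /f /=; have := ltn_ord i; rewrite leq_eqVlt => /orP[/eqP ic|ic].
    have -> : nat_of_ord i = size (u1 :: p) by move: ic => /= [].
    rewrite modnn [nth _ _ (size _)](_ : _ = u2) /= 1?adj_sym //.
    by rewrite -lp; apply: (nth_last v c).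
  rewrite modn_small //; have : path (@adj G) v (u1 :: p) by rewrite /= vu1.
  by move/(pathP v)/(_ i); apply.
exists f.
  by move=> i j /eqP; rewrite nth_uniq // => /eqP /val_inj.
by move=> i j /andP[_ /orP[]/eqP->]; rewrite // adj_sym.
Qed.

(** Three internally disjoint paths from [v] to [w] are a theta subgraph; the
lists [s1], [s2], [s3] hold their internal vertices. *)
Lemma theta_embedding (G : sgraph) (v w : G) (s1 s2 s3 : seq G) :
  path (@adj G) v (rcons s1 w) -> path (@adj G) v (rcons s2 w) ->
  path (@adj G) v (rcons s3 w) -> uniq [:: v, w & s1 ++ s2 ++ s3] ->
  exists2 f : theta_graph (size s1).+1 (size s2).+1 (size s3).+1 -> G,
    injective f & forall x y, adj x y -> adj (f x) (f y).
Proof.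
move=> p1 p2 p3 us.
pose f (x : theta_vertex (size s1).+1 (size s2).+1 (size s3).+1) : G :=
  match x with
  | inl false => v
  | inl true => w
  | inr (inl (inl i)) => nth v s1 i
  | inr (inl (inr i)) => nth v s2 i
  | inr (inr i) => nth v s3 i
  end.
exists f.
  (* Injectivity: [rank] is the place of [f x] in the duplicate-free list. *)
  pose rank (x : theta_vertex (size s1).+1 (size s2).+1 (size s3).+1) : nat :=
    match x with
    | inl false => 0
    | inl true => 1
    | inr (inl (inl i)) => i.+2
    | inr (inl (inr i)) => (size s1 + i).+2
    | inr (inr i) => (size s1 + (size s2 + i)).+2
    end.
  have rank_lt x : rank x < size [:: v, w & s1 ++ s2 ++ s3].
    rewrite /= !size_cat.
    by case: x => [[]|[[[i li]|[i li]]|[i li]]] //=; move: li => /=; lia.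
  have fE x : f x = nth v [:: v, w & s1 ++ s2 ++ s3] (rank x).
    case: x => [[]|[[[i li]|[i li]]|[i li]]] //=; rewrite !nth_cat.
    - by rewrite li.
    - by rewrite ltnNge leq_addr /= addKn li.
    - by rewrite ltnNge leq_addr /= addKn ltnNge leq_addr /= addKn.
  have rank_inj : injective rank.
    move=> [[]|[[[i li]|[i li]]|[i li]]] [[]|[[[j lj]|[j lj]]|[j lj]]] //=;
      move: li lj => /= *; try lia.
    - by congr (inr (inl (inl _))); apply: val_inj => /=; lia.
    - by congr (inr (inl (inr _))); apply: val_inj => /=; lia.
    - by congr (inr (inr _)); apply: val_inj => /=; lia.
  by move=> x y; rewrite !fE => /eqP; rewrite nth_uniq // => /eqP/rank_inj.
have step s x y i j : path (@adj G) v (rcons s w) ->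
    f x = nth v (v :: rcons s w) i -> f y = nth v (v :: rcons s w) j ->
    i <= (size s).+1 -> j <= (size s).+1 ->
    consecutive (Some i) (Some j) -> adj (f x) (f y).
  move=> /(pathP v); rewrite size_rcons => ps fx fy li lj /orP[]/eqP E.
    by rewrite fx fy E /=; apply: ps; rewrite -E.
  by rewrite adj_sym fx fy E /=; apply: ps; rewrite -E.
have pos x (k : nat) : let: (q1, q2, q3) := theta_pos x in
    [/\ q1 = Some k -> k <= (size s1).+1 /\ f x = nth v (v :: rcons s1 w) k,
        q2 = Some k -> k <= (size s2).+1 /\ f x = nth v (v :: rcons s2 w) k
      & q3 = Some k -> k <= (size s3).+1 /\ f x = nth v (v :: rcons s3 w) k].
  case: x => [[]|[[[i li]|[i li]]|[i li]]] /=; split=> // -[<-] //=;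
    rewrite ?nth_rcons ?ltnn ?eqxx //; move: li => /= li; rewrite li //;
    by split=> //; lia.
move=> x y; rewrite /= /theta_adj; move: (pos x) (pos y).
case: (theta_pos x) => [[q1 q2] q3]; case: (theta_pos y) => [[r1 r2] r3] px py.
case/or3P.
- case: q1 px => [i|//] px; case: r1 py => [j|//] py.
  have [/(_ erefl)[li fi] _ _] := px i; have [/(_ erefl)[lj fj] _ _] := py j.
  exact: (step s1).
- case: q2 px => [i|//] px; case: r2 py => [j|//] py.
  have [_ /(_ erefl)[li fi] _] := px i; have [_ /(_ erefl)[lj fj] _] := py j.
  exact: (step s2).
- case: q3 px => [i|//] px; case: r3 py => [j|//] py.
  have [_ _ /(_ erefl)[li fi]] := px i; have [_ _ /(_ erefl)[lj fj]] := py j.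
  exact: (step s3).
Qed.

(** Take [v] with three neighbours [u1], [u2], [u3] and a path [P] from [u1] to
[u2] in [G - v].  Follow a path from [u3] to [u1] in [G - v] until it first meets
[P], at [w]: then [v] and [w] are joined by the two parts of [P] and by the
initial segment of the second path.  At most one of the three is a single
edge, since [w] equals at most one of the [u]s. *)
Lemma exists_theta (G : sgraph) :
  vertex_connected 2 G -> 2 * #|G| < \sum_(x : G) degree x ->
  exists a b c, theta_lengths a b c /\
    exists2 f : theta_graph a b c -> G,
      injective f & forall x y, adj x y -> adj (f x) (f y).
Proof.
move=> conn big.
have [v /card_gt2P[u1 [u2 [u3 []]]]] : exists v : G, 2 < degree v.
  apply/existsP; apply: contraTT big; rewrite negb_exists => /forallP small.
  rewrite -leqNgt mulnC -sum_nat_const; apply: leq_sum => x _.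
  by rewrite leqNgt.
rewrite !inE => -[vu1 vu2 vu3] [u12 u23 u31].
have nv u : adj v u -> u \notin [set v].
  by move=> vu; rewrite inE; apply: contraTneq vu => ->; rewrite adj_irr.
have c1 : #|[set v]| < 2 by rewrite cards1.
have [p [pp lp up vp]] := path_avoiding conn c1 (nv _ vu1) (nv _ vu2).
have [q [qq lq uq vq]] := path_avoiding conn c1 (nv _ vu3) (nv _ vu1).
have {}vp : v \notin u1 :: p by apply/negP => /(allP vp); rewrite /= inE eqxx.
have {}vq : v \notin u3 :: q by apply/negP => /(allP vq); rewrite /= inE eqxx.
pose i := find (mem (u1 :: p)) (u3 :: q).
have hq : has (mem (u1 :: p)) (u3 :: q).
  by apply/hasP; exists u1; rewrite /= -?lq ?mem_last // inE eqxx.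
have iq : i < size (u3 :: q) by rewrite -has_find.
pose s3 := take i (u3 :: q); pose w := nth v (u3 :: q) i.
have wp : w \in u1 :: p by apply: (nth_find v hq).
have p3 : path (@adj G) v (rcons s3 w).
  by rewrite /s3 /w -take_nth // take_path //= vu3.
have us3 : uniq s3 by apply: take_uniq.
have vs3 : v \notin s3 by apply: contra vq; apply: mem_take.
have ds3 x : x \in s3 -> x \notin u1 :: p.
  move=> /(nthP v)[j]; rewrite size_take iq => ji <-.
  by rewrite nth_take //; apply/negbT/(before_find v ji).
have w3 : size s3 = 0 -> w = u3.
  by rewrite /w size_take iq => ->.
have hp : head v (u1 :: p) = u1 by [].
have lp' : last v (u1 :: p) = u2 by [].
have pv : path (@adj G) v (u1 :: p) by rewrite /= vu1.
clearbody s3 w; clear i hq iq.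
move: (u1 :: p) pv up vp wp ds3 hp lp' => P pv up vp wp.
case/splitPr: wp pv up vp => s1 r pv up vp ds3 hp lp'.
exists (size s1).+1, (size (rev r)).+1, (size s3).+1; split.
  have w1 : size s1 = 0 -> w = u1 by move/size0nil => E; move: hp; rewrite E.
  have w2 : size (rev r) = 0 -> w = u2.
    by rewrite size_rev => /size0nil E; move: lp'; rewrite E last_cat.
  rewrite /theta_lengths /=.
  case: (size s1) w1 => [/(_ erefl) w1|? _];
    case: (size (rev r)) w2 => [/(_ erefl) w2|? _] //=;
    case: (size s3) w3 => [/(_ erefl) w3|? _] //=.
  - by rewrite -w1 w2 eqxx in u12.
  - by rewrite -w1 w2 eqxx in u12.
  - by rewrite -w1 w3 eqxx in u31.
  - by rewrite -w2 w3 eqxx in u23.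
apply: (theta_embedding (v := v) (w := w)) => //.
- by move: pv; rewrite -cat_rcons cat_path => /andP[].
- move: pv; rewrite cat_path /= => /and3P[_ _ pr].
  have : path (@adj G) w (rcons r v).
    by rewrite rcons_path pr adj_sym; move: lp'; rewrite last_cat /= => ->.
  have := rev_path (@adj G) w (rcons r v); rewrite last_rcons belast_rcons rev_cons.
  move=> -> pw; rewrite (eq_path (e' := @adj G)) // => y z.
  exact: adj_sym.
- have [us1 ws1 dis wr ur] :
      [/\ uniq s1, w \notin s1, ~~ has (mem s1) r, w \notin r & uniq r].
    by move: up; rewrite cat_uniq /= negb_or => /and3P[-> /andP[-> ->] /andP[-> ->]].
  move: vp; rewrite mem_cat inE !negb_or => /and3P[vs1 vw vr].
  have ds x : x \in s3 -> [/\ x \notin s1, x != w & x \notin r].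
    by move/ds3; rewrite mem_cat inE !negb_or => /and3P[].
  have ws3 : w \notin s3 by apply/negP => /ds[]; rewrite eqxx.
  rewrite !cons_uniq inE !mem_cat !mem_rev !negb_or vw vs1 vr vs3 ws1 wr ws3 /=.
  rewrite !cat_uniq us1 rev_uniq ur us3 !andbT /=; apply/andP; split.
    apply/hasPn => x; rewrite mem_cat mem_rev => /orP[xr|/ds[]//].
    by apply: contra dis => xs; apply/hasP; exists x.
  by apply/hasPn => x /ds[_ _]; rewrite mem_rev.
Qed.

(** * Bipartite cycles and theta graphs *)

Lemma even_cycle_colorable (n : nat) : ~~ odd n -> colorable (cycle_graph n) 2.
Proof.
move=> n_even.
have S (i : 'I_n) : odd (ordS i) = ~~ odd i.
  rewrite /=; have := ltn_ord i; rewrite leq_eqVlt => /orP[/eqP e|e].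
    by rewrite e modnn; move: n_even; rewrite -[in odd n]e /= negbK => ->.
  by rewrite modn_small.
apply: (@colorable2_bool (cycle_graph n) (fun i => odd (i : 'I_n))) => x y.
by move=> /andP[_ /orP[]/eqP->]; rewrite S; case: odd.
Qed.

Lemma odd_theta_colorable (a b c : nat) :
  odd a -> odd b -> odd c -> colorable (theta_graph a b c) 2.
Proof.
move=> oa ob oc; pose f (x : theta_vertex a b c) : bool := match x with
  | inl d => d
  | inr (inl (inl i)) => odd i.+1
  | inr (inl (inr i)) => odd i.+1
  | inr (inr i) => odd i.+1 end.
have fE x k : let: (p1, p2, p3) := theta_pos x in
    p1 = Some k \/ p2 = Some k \/ p3 = Some k -> f x = odd k.
  by case: x => [[]|[[i|i]|i]] /= [|[]] // [<-].
apply: (@colorable2_bool (theta_graph a b c) f) => x y.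
rewrite /= /theta_adj; move: (fE x) (fE y).
have step i j : consecutive (Some i) (Some j) -> odd i != odd j.
  by move=> /orP[]/eqP->; rewrite /=; case: odd.
case: (theta_pos x) => [[q1 q2] q3]; case: (theta_pos y) => [[r1 r2] r3] px py.
case/or3P.
- case: q1 px => [i|//] px; case: r1 py => [j|//] py.
  by rewrite (px i) ?(py j); auto; apply: step.
- case: q2 px => [i|//] px; case: r2 py => [j|//] py.
  by rewrite (px i) ?(py j); auto; apply: step.
- case: q3 px => [i|//] px; case: r3 py => [j|//] py.
  by rewrite (px i) ?(py j); auto; apply: step.
Qed.

Lemma colorable_iso (k : nat) (G H : sgraph) :
  graph_iso G H -> colorable H k -> colorable G k.
Proof.
case=> f _ fadj /existsP[h /forallP hP]; apply/existsP; exists [ffun x => h (f x)].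
apply/forallP => x; apply/forallP => y; rewrite !ffunE -fadj.
by move/forallP: (hP (f x)).
Qed.

(** * Graphs of least degree sum *)

Lemma cycle_of_degree_sum (G : sgraph) :
  vertex_connected 2 G -> \sum_(x : G) degree x <= 2 * #|G| ->
  graph_iso G (cycle_graph #|G|).
Proof.
move=> conn small; have [k [k3 [f finj fhom]]] := exists_cycle conn.
have iso : graph_iso G (cycle_graph k).
  apply: (embedding_iso (f := f)) => //.
  - by case: k k3 {f finj fhom} => // k _; apply: ord0.
  - exact: connected_of_2connected.
  - exact: mindeg2_of_2connected.
  - by rewrite cycle_degree_sum // card_ord addnC leq_add2l.
suff -> : #|G| = k by [].
by case: iso => g gbij _; rewrite (bij_eq_card gbij) card_ord.
Qed.

Lemma theta_of_degree_sum (G : sgraph) :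
  vertex_connected 2 G -> \sum_(x : G) degree x = 2 * #|G|.+1 ->
  exists a b c, theta_lengths a b c /\ graph_iso G (theta_graph a b c).
Proof.
move=> conn sumG; have [|a [b [c [len [f finj fhom]]]]] := exists_theta conn.
  by rewrite sumG; lia.
exists a, b, c; split=> //; apply: (embedding_iso (f := f)) => //.
- exact: (inl true).
- exact: connected_of_2connected.
- exact: mindeg2_of_2connected.
- rewrite sumG theta_degree_sum // card_theta //.
  by have /and4P[a0 b0 c0 _] := len; lia.
Qed.

(** * The extremal graphs *)

Theorem theorem1p5 (n : nat) (G : sgraph) (hn : 4 <= n) (hG : #|G| = n)
    (hchi : chromatic_number G = 3) (hconn : vertex_connected 2 G) :
  (odd n ->
     indep_count 2 G <= indep_count 2 (cycle_graph n) /\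
     (indep_count 2 G = indep_count 2 (cycle_graph n) <->
      graph_iso G (cycle_graph n))) /\
  (~~ odd n ->
     forall a b c : nat, theta_lengths a b c -> #|theta_graph a b c| = n ->
     some_even a b c ->
     indep_count 2 G <= indep_count 2 (theta_graph a b c) /\
     (indep_count 2 G = indep_count 2 (theta_graph a b c) <->
      exists a' b' c' : nat,
        [/\ theta_lengths a' b' c', #|theta_graph a' b' c'| = n,
            some_even a' b' c' & graph_iso G (theta_graph a' b' c')])) /\
  (forall t : nat, 3 <= t <= n - 2 ->
     indep_count t G
       <= indep_count t (join_graph (complete_graph 2) (empty_graph (n - 2))) /\
     (5 <= n ->
      (indep_count t G
         = indep_count t (join_graph (complete_graph 2) (empty_graph (n - 2))) <->
       graph_iso G (join_graph (complete_graph 2) (empty_graph (n - 2)))))).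
Proof.
have ncol : ~~ colorable G 2.
  apply/negP => col; move: hchi; rewrite /chromatic_number.
  by case: ex_minnP => m _ /(_ 2 col) m2 m3; rewrite m3 in m2.
have deg2 := mindeg2_of_2connected hconn.
have sumG : 2 * n <= \sum_(x : G) degree x.
  by rewrite -hG mulnC -sum_nat_const; apply: leq_sum.
have countG := indep_count2 G; rewrite hG in countG.
split; [|split].
- move=> n_odd; have n3 := ltnW hn.
  have := indep_count2 (cycle_graph n); rewrite cycle_degree_sum // card_ord => countC.
  split; first by move: sumG countG countC; lia.
  split=> [E|]; last exact: indep_count_iso.
  rewrite -[in cycle_graph n]hG; apply: cycle_of_degree_sum => //.
  by rewrite hG; move: E countG countC; lia.
- move=> n_even a b c len card_n _.
  have theta_sum a' b' c' : theta_lengths a' b' c' -> #|theta_graph a' b' c'| = n ->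
      \sum_(x : theta_graph a' b' c') degree x = 2 * n.+1.
    move=> len' <-; rewrite theta_degree_sum // card_theta //.
    by have /and4P[a0 b0 c0 _] := len'; lia.
  have := indep_count2 (theta_graph a b c); rewrite theta_sum // card_n => countT.
  (* Degree sum [2n] would make [G] an even cycle, which is bipartite. *)
  have : 2 * n < \sum_(x : G) degree x.
    rewrite ltnNge; apply: contra ncol => small.
    apply: colorable_iso (even_cycle_colorable n_even).
    by rewrite -[in cycle_graph n]hG; apply: cycle_of_degree_sum; rewrite ?hG.
  (* The degree sum is even, so exceeding [2n] it is at least [2n + 2]. *)
  have n_even2 : ~~ odd (n * n.-1) by rewrite oddM (negPf n_even).
  move=> gt2n; split; first by move: gt2n countG countT n_even2; lia.
  split=> [E|[a' [b' [c' [len' card' _ iso]]]]]; last first.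
    rewrite (indep_count_iso _ iso).
    have := indep_count2 (theta_graph a' b' c'); rewrite theta_sum // card'.
    by move: countT; lia.
  have [|a' [b' [c' [len' iso]]]] := theta_of_degree_sum hconn.
    by rewrite hG; move: E countG countT; lia.
  exists a', b', c'; split=> //.
    by case: iso => f fbij _; rewrite -hG (bij_eq_card fbij).
  apply: contraNT ncol; rewrite !negb_or !negbK => /and3P[oa ob oc].
  exact: colorable_iso iso (odd_theta_colorable oa ob oc).
- move=> t tn; have Gm : #|G| = (n - 2).+2 by rewrite hG; lia.
  have [le eq] := indep_count_mindeg2 Gm deg2 tn.
  have t2 : 2 <= t by case/andP: tn => /ltnW.
  rewrite indep_count_join //; split=> // _; split=> [/eq[v [w [vw ind]]]|iso].
    exact: join_iso vw ind.
  by rewrite (indep_count_iso _ iso) indep_count_join.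
Qed.
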